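(* Let $0<|q|<1$ and let $a,s,t$ be complex numbers with $s,t\neq 0$ and $\left|\frac{1}{st}\right|<1$, such that no denominator below vanishes. Then \[ \sum_{n=0}^{\infty}\frac{(a^2,aq^2,-aq^2;q^2)_n\,(s,t;q)_n}{(q^2,a,-a;q^2)_n\,(aq/s,aq/t;q)_n}\left(-\frac{1}{st}\right)^n =\frac{s+t}{st}\,\frac{(aq,-q/s,-q/t,aq/(st);q)_\infty}{(-q,aq/s,aq/t,-1/(st);q)_\infty}. \]
   Context: For $0<|q|<1$: $(x;q)_\infty=\prod_{i=0}^{\infty}(1-xq^i)$ and $(x;q)_n=(x;q)_\infty/(xq^n;q)_\infty$ for any integer $n$. Also $(x_1,\dots,x_r;q)_k=(x_1;q)_k\cdots(x_r;q)_k$ for $k$ an integer or $\infty$. *)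

(* Defs.v *)
From Stdlib Require Export Reals List.
From Stdlib Require Import Lra Lia.
From Coquelicot Require Export Coquelicot.
Export ListNotations.

Open Scope R_scope.
Open Scope C_scope.

(* For n >= 0 the quotient (x;q)_oo / (x q^n;q)_oo is read as the finite product
   it reduces to, so that it also makes sense when (x q^n;q)_oo = 0, i.e. for
   x = q^(-k) with k >= n; see [qpoch_ratio]. *)
Fixpoint qpoch (x q : C) (n : nat) : C :=
  match n with
  | O => 1
  | S m => qpoch x q m * (1 - x * q ^ m)
  end.

(* [iota] picks the unique limit; existence for |q| < 1 is [qpoch_inf_correct]. *)
Definition qpoch_inf (x q : C) : C :=
  iota (T := C_CompleteNormedModule)
    (fun l : C => filterlim (qpoch x q) eventually (locally l)).

Definition qpochs (xs : list C) (q : C) (n : nat) : C :=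
  fold_right (fun x p => qpoch x q n * p) (RtoC 1) xs.

Definition qpochs_inf (xs : list C) (q : C) : C :=
  fold_right (fun x p => qpoch_inf x q * p) (RtoC 1) xs.

Lemma qpoch_bound (x q : C) (n : nat) : (Cmod q < 1)%R ->
  (Cmod (qpoch x q n) <= exp (Cmod x * ((1 - Cmod q ^ n) / (1 - Cmod q))))%R.
Proof.
intros hq. induction n as [|n IH].
- simpl. rewrite Cmod_1.
  replace (Cmod x * ((1 - 1) / (1 - Cmod q)))%R with 0%R by (field; lra).
  rewrite exp_0. lra.
- simpl qpoch. rewrite Cmod_mult.
  replace (Cmod x * ((1 - Cmod q ^ S n) / (1 - Cmod q)))%R
    with (Cmod x * ((1 - Cmod q ^ n) / (1 - Cmod q)) + Cmod x * Cmod q ^ n)%R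
    by (simpl; field; lra).
  rewrite exp_plus.
  apply Rmult_le_compat; try apply Cmod_ge_0; [exact IH|].
  apply Rle_trans with (1 + Cmod x * Cmod q ^ n)%R.
  + unfold Cminus. eapply Rle_trans; [apply Cmod_triangle|].
    rewrite Cmod_1, Cmod_opp, Cmod_mult, Cmod_pow. lra.
  + apply exp_ineq1_le.
Qed.

Lemma ex_qpoch_inf (x q : C) : (Cmod q < 1)%R ->
  exists l : C, filterlim (qpoch x q) eventually (locally l).
Proof.
intros hq.
pose (M := exp (Cmod x * / (1 - Cmod q))).
pose (d := fun n => - (x * q ^ n * qpoch x q n)).
assert (hd : @ex_series C_AbsRing C_NormedModule d).
{ apply (@ex_series_le C_AbsRing C_CompleteNormedModule)
    with (b := fun n => (Cmod x * M * Cmod q ^ n)%R).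
  - intro n. change (Cmod (d n) <= Cmod x * M * Cmod q ^ n)%R.
    unfold d. rewrite Cmod_opp, !Cmod_mult, Cmod_pow.
    assert (h0 := Cmod_ge_0 x).
    assert (h1 := pow_le (Cmod q) n (Cmod_ge_0 q)).
    assert (h2 : (Cmod (qpoch x q n) <= M)%R).
    { eapply Rle_trans; [apply qpoch_bound; exact hq|].
      unfold M.
      destruct (Rle_lt_or_eq_dec (Cmod x * ((1 - Cmod q ^ n) / (1 - Cmod q)))
                  (Cmod x * / (1 - Cmod q))) as [h|h].
      - apply Rmult_le_compat_l; [exact h0|].
        unfold Rdiv. rewrite <- (Rmult_1_l (/ (1 - Cmod q))) at 2.
        apply Rmult_le_compat_r; [|lra].
        left; apply Rinv_0_lt_compat; lra.
      - left; now apply exp_increasing.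
      - rewrite h; lra. }
    replace (Cmod x * M * Cmod q ^ n)%R with (Cmod x * Cmod q ^ n * M)%R by ring.
    apply Rmult_le_compat_l; [|exact h2].
    now apply Rmult_le_pos.
  - apply (ex_series_scal (K := R_AbsRing) (V := R_NormedModule)).
    apply ex_series_geom. rewrite Rabs_pos_eq; [exact hq|apply Cmod_ge_0]. }
destruct hd as [l hl].
exists (1 + l).
assert (hsum : forall n, qpoch x q (S n) = 1 + @sum_n C_AbelianMonoid d n).
{ induction n as [|n IH].
  - rewrite sum_O. unfold d. simpl. ring.
  - rewrite sum_Sn. change (qpoch x q (S n) * (1 - x * q ^ S n)
      = 1 + (@sum_n C_AbelianMonoid d n + d (S n))).
    rewrite Cplus_assoc, <- IH. unfold d. ring. }
assert (h : filterlim (fun n => 1 + @sum_n C_AbelianMonoid d n) eventually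
          (locally (1 + l))).
{ apply (filterlim_comp_2 (G := locally (RtoC 1)) (H := locally l)
    (F := eventually) (fun _ => RtoC 1) (@sum_n C_AbelianMonoid d) Cplus).
  - apply filterlim_const.
  - exact hl.
  - apply (@filterlim_plus C_AbsRing C_NormedModule). }
intros P hP. destruct (h P hP) as [N hN].
exists (S N). intros [|n] hn; [lia|].
rewrite hsum. apply hN. lia.
Qed.

Lemma qpoch_inf_unique (x q l : C) :
  filterlim (qpoch x q) eventually (locally l) -> qpoch_inf x q = l.
Proof.
intro h. exact (iota_filterlim_locally (V := C_CompleteNormedModule) _ _ h).
Qed.

Lemma qpoch_inf_correct (x q : C) : (Cmod q < 1)%R ->
  filterlim (qpoch x q) eventually (locally (qpoch_inf x q)).
Proof.
intro hq. destruct (ex_qpoch_inf x q hq) as [l hl].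
now rewrite (qpoch_inf_unique _ _ _ hl).
Qed.

Lemma qpoch_add (x q : C) (n m : nat) :
  qpoch x q (n + m) = qpoch x q n * qpoch (x * q ^ n) q m.
Proof.
induction m as [|m IH].
- rewrite Nat.add_0_r. simpl. ring.
- rewrite Nat.add_succ_r. simpl. rewrite IH, Cpow_add_r. ring.
Qed.

Lemma qpoch_ratio (x q : C) (n : nat) : (Cmod q < 1)%R ->
  qpoch_inf (x * q ^ n) q <> 0 ->
  qpoch x q n = qpoch_inf x q / qpoch_inf (x * q ^ n) q.
Proof.
intros hq h0.
assert (e : qpoch_inf x q = qpoch x q n * qpoch_inf (x * q ^ n) q).
{ apply qpoch_inf_unique.
  assert (h : filterlim (fun m => qpoch x q n * qpoch (x * q ^ n) q m) eventually
            (locally (qpoch x q n * qpoch_inf (x * q ^ n) q))).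
  { apply (filterlim_comp _ _ _ _ (fun z => qpoch x q n * z) _ _ _
      (qpoch_inf_correct (x * q ^ n) q hq)).
    apply (@filterlim_scal_r C_AbsRing C_NormedModule). }
  intros P hP. destruct (h P hP) as [N hN].
  exists (n + N)%nat. intros m hm.
  replace m with (n + (m - n))%nat by lia.
  rewrite qpoch_add. apply hN. lia. }
rewrite e. field. exact h0.
Qed.

(* Main.v *)
Require Import Defs.
From Stdlib Require Import Lra Lia.
Open Scope C_scope.

(** The identity [q^(-n) (1 + a q^(2n)) = (1 + a) - (1 - q^(-n)) (1 - a q^n)]
    splits the series into two very-well-poised 6phi5 series, one with
    parameters [(a; -a, s, t)] and, after an index shift,
    one with [(a q^2; -a q, s q, t q)].
    The nonterminating 6phi5 sum itself follows from a WZ-type first-order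
    recurrence in [a -> a q] (with [b, c, d] fixed), iterated until only the
    constant term of the series survives. *)

(** Reduced to base q, the summand is a very-well-poised term with b = -a, times (1 + a q^(2n))/(1 +
    a), taken at the argument -1/(st), whereas the 6phi5 sum with b = -a requires -q/(st). The
    missing q^(-n) and the extra 1 + a q^(2n) form the left side of the identity above. On its
    right, 1 + a is constant in n, while (1 - q^(-n))(1 - a q^n) vanishes at n = 0 and is what the
    index shift absorbs: one factor shortens (q;q)_n, the other lengthens (a;q)_n.

    The delicate point of the 6phi5 sum is exchanging the limit k -> oo of the iterated shifts with
    the summation. This needs a bound on the shifted terms uniform in k, hence lower bounds on |(x
    q^k;q)_n| uniform in both k and n; these are extracted from the mere nonvanishing of the finite
    denominators. *)

(** * Limits and geometrically dominated series in C *)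

Lemma Cfilterlim_unique (u : nat -> C) (l l' : C) :
  filterlim u eventually (locally l) -> filterlim u eventually (locally l') ->
  l = l'.
Proof.
apply (@filterlim_locally_unique nat C_AbsRing C_NormedModule eventually _ u l l').
Qed.

(** [filterlim_mult] refers to the uniform structure of the absolute ring, limits here to the
    product structure of [C]; [locally_C] identifies the neighbourhoods. *)
Lemma Cfilterlim_mult (u v : nat -> C) (lu lv : C) :
  filterlim u eventually (locally lu) -> filterlim v eventually (locally lv) ->
  filterlim (fun n => u n * v n) eventually (locally (lu * lv)).
Proof.
intros hu hv.
assert (h : filterlim (fun n => u n * v n) eventually
              (locally (T := AbsRing_UniformSpace C_AbsRing) (lu * lv))).
{ apply (filterlim_comp_2 (F := eventually)
    (G := locally (T := AbsRing_UniformSpace C_AbsRing) lu)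
    (H := locally (T := AbsRing_UniformSpace C_AbsRing) lv) u v Cmult).
  - intros P hP; apply hu, locally_C, hP.
  - intros P hP; apply hv, locally_C, hP.
  - apply (@filterlim_mult C_AbsRing). }
intros P hP; apply h, locally_C, hP.
Qed.

Lemma Cfilterlim_bound (u : nat -> C) (l : C) (K r : R) :
  (0 <= r < 1)%R -> (forall n, Cmod (u n - l) <= K * r ^ n)%R ->
  filterlim u eventually (locally l).
Proof.
intros hr hb.
apply (@filterlim_locally_ball_norm C_AbsRing nat C_NormedModule eventually _ u l).
intro eps.
assert (h : is_lim_seq (fun n => K * r ^ n)%R 0).
{ replace (Finite 0) with (Rbar_mult K 0) by (simpl; f_equal; ring).
  apply is_lim_seq_scal_l, is_lim_seq_geom.
  rewrite Rabs_pos_eq; lra. }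
apply is_lim_seq_spec in h. destruct (h eps) as [N hN].
exists N. intros n hn.
change (Cmod (u n - l) < eps)%R.
eapply Rle_lt_trans; [apply hb|].
eapply Rle_lt_trans; [|apply (hN n hn)].
rewrite Rminus_0_r. apply Rle_abs.
Qed.

Lemma C_ex_series_geom (u : nat -> C) (K r : R) :
  (0 <= r < 1)%R -> (forall n, Cmod (u n) <= K * r ^ n)%R ->
  @ex_series C_AbsRing C_NormedModule u.
Proof.
intros hr hb.
apply (@ex_series_le C_AbsRing C_CompleteNormedModule)
  with (b := fun n => (K * r ^ n)%R); [exact hb|].
apply (ex_series_scal (K := R_AbsRing) (V := R_NormedModule)).
apply ex_series_geom. rewrite Rabs_pos_eq; lra.
Qed.

Lemma C_series_geom_bound (u : nat -> C) (l : C) (K r : R) :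
  (0 <= r < 1)%R -> (forall n, Cmod (u n) <= K * r ^ n)%R ->
  @is_series C_AbsRing C_NormedModule u l -> (Cmod l <= K / (1 - r))%R.
Proof.
intros hr hb hl.
assert (hK : (0 <= K)%R).
{ generalize (hb O) (Cmod_ge_0 (u O)). simpl. lra. }
assert (h : is_lim_seq (fun n => Cmod (@sum_n C_AbelianMonoid u n)) (Cmod l)).
{ exact (filterlim_comp _ _ _ _ _ _ _ _ hl
    (@filterlim_norm C_AbsRing C_NormedModule l)). }
apply (is_lim_seq_le _ (fun _ => (K / (1 - r))%R) (Cmod l) (K / (1 - r))%R)
  with (2 := h) (3 := is_lim_seq_const _).
intro n.
eapply Rle_trans; [apply (@norm_sum_n_m C_AbsRing C_NormedModule u 0 n)|].
eapply Rle_trans; [apply sum_n_m_le with (b := fun k => (K * r ^ k)%R); exact hb|].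
change (sum_n (fun k => mult K (r ^ k)%R) n <= K / (1 - r))%R.
rewrite sum_n_mult_l, sum_n_Reals, tech3 by lra.
change (K * ((1 - r ^ S n) / (1 - r)) <= K / (1 - r))%R.
unfold Rdiv. apply Rmult_le_compat_l; [exact hK|].
rewrite <- (Rmult_1_l (/ (1 - r))) at 2.
apply Rmult_le_compat_r.
- left; apply Rinv_0_lt_compat; lra.
- generalize (pow_le r (S n)). lra.
Qed.

(** * Uniform upper and lower bounds for q-shifted factorials *)

Lemma qpoch_bounded (x q : C) (n : nat) : (Cmod q < 1)%R ->
  (Cmod (qpoch x q n) <= exp (Cmod x / (1 - Cmod q)))%R.
Proof.
intro hq. eapply Rle_trans; [apply qpoch_bound; exact hq|].
assert (h : (Cmod x * ((1 - Cmod q ^ n) / (1 - Cmod q))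
             <= Cmod x / (1 - Cmod q))%R).
{ apply Rmult_le_compat_l; [apply Cmod_ge_0|].
  rewrite <- (Rmult_1_l (/ (1 - Cmod q))).
  apply Rmult_le_compat_r.
  - left; apply Rinv_0_lt_compat; lra.
  - generalize (pow_le (Cmod q) n (Cmod_ge_0 q)). lra. }
destruct h as [h|h]; [left; now apply exp_increasing|rewrite h; lra].
Qed.

Lemma Cmod_mul_pow_le (x q : C) (n : nat) : (Cmod q < 1)%R ->
  (Cmod (x * q ^ n) <= Cmod x)%R.
Proof.
intro hq. rewrite Cmod_mult, Cmod_pow.
rewrite <- (Rmult_1_r (Cmod x)) at 2.
apply Rmult_le_compat_l; [apply Cmod_ge_0|].
rewrite <- (pow1 n). apply pow_incr. generalize (Cmod_ge_0 q). lra.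
Qed.

(** The bound of [qpoch_bounded] increases with |x|, and |x q^k| <= |x|, so the value at [k = 0]
    serves all shifts. *)
Lemma qpoch_shift_bounded (x q : C) : (Cmod q < 1)%R ->
  exists M, forall k n, (Cmod (qpoch (x * q ^ k) q n) <= M)%R.
Proof.
intro hq. exists (exp (Cmod x / (1 - Cmod q))). intros k n.
eapply Rle_trans; [apply qpoch_bounded; exact hq|].
assert (h : (Cmod (x * q ^ k) / (1 - Cmod q) <= Cmod x / (1 - Cmod q))%R).
{ apply Rmult_le_compat_r.
  - left; apply Rinv_0_lt_compat; lra.
  - now apply Cmod_mul_pow_le. }
destruct h as [h|h]; [left; now apply exp_increasing|rewrite h; lra].
Qed.

(* Weierstrass' inequality [prod (1 - u_i) >= 1 - sum u_i]. *)
Lemma qpoch_lower_bound (x q : C) (n : nat) : (Cmod q < 1)%R ->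
  (Cmod x / (1 - Cmod q) <= 1 / 2)%R ->
  (1 - Cmod x * ((1 - Cmod q ^ n) / (1 - Cmod q)) <= Cmod (qpoch x q n))%R.
Proof.
intros hq hx. induction n as [|n IH].
- simpl. rewrite Cmod_1.
  replace (Cmod x * ((1 - 1) / (1 - Cmod q)))%R with 0%R by (field; lra). lra.
- simpl qpoch. rewrite Cmod_mult.
  replace (Cmod x * ((1 - Cmod q ^ S n) / (1 - Cmod q)))%R
    with (Cmod x * ((1 - Cmod q ^ n) / (1 - Cmod q)) + Cmod x * Cmod q ^ n)%R
    by (simpl; field; lra).
  set (s := (Cmod x * ((1 - Cmod q ^ n) / (1 - Cmod q)))%R) in *.
  assert (hp := pow_le (Cmod q) n (Cmod_ge_0 q)).
  assert (hp1 : (Cmod q ^ n <= 1)%R).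
  { rewrite <- (pow1 n). apply pow_incr. generalize (Cmod_ge_0 q). lra. }
  assert (h0 := Cmod_ge_0 x).
  assert (hi : (0 < / (1 - Cmod q))%R) by (apply Rinv_0_lt_compat; lra).
  assert (hs : (0 <= s <= 1 / 2)%R).
  { unfold s, Rdiv in *. split;
      [apply Rmult_le_pos; [exact h0|apply Rmult_le_pos; [lra|now left]]|].
    apply Rle_trans with (Cmod x * / (1 - Cmod q))%R; [|exact hx].
    apply Rmult_le_compat_l; [lra|].
    rewrite <- (Rmult_1_l (/ (1 - Cmod q))) at 2.
    apply Rmult_le_compat_r; lra. }
  assert (hx1 : (Cmod x <= 1 / 2)%R).
  { apply Rle_trans with (Cmod x / (1 - Cmod q))%R; [|exact hx].
    rewrite <- (Rmult_1_r (Cmod x)) at 1.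
    apply Rmult_le_compat_l; [lra|].
    rewrite <- Rinv_1. apply Rinv_le_contravar; [lra|].
    generalize (Cmod_ge_0 q). lra. }
  assert (hd : (1 - Cmod x * Cmod q ^ n <= Cmod (1 - x * q ^ n))%R).
  { rewrite <- Cmod_pow, <- Cmod_mult.
    assert (h := Cmod_triangle (1 - x * q ^ n) (x * q ^ n)).
    replace (1 - x * q ^ n + x * q ^ n) with (RtoC 1) in h by ring.
    rewrite Cmod_1 in h. lra. }
  assert (hxp := Rmult_le_pos _ _ h0 hp).
  assert (hsxp := Rmult_le_pos _ _ (proj1 hs) hxp).
  apply Rle_trans with ((1 - s) * (1 - Cmod x * Cmod q ^ n))%R; [lra|].
  apply Rmult_le_compat; [lra|nra|exact IH|exact hd].
Qed.

(** Beyond some [N] the remaining factors are so close to 1 that Weierstrass' inequality keeps their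
    product at least 1/2 in modulus; the first [N] factors contribute a fixed nonzero product. *)
Lemma qpoch_away_from_0 (x q : C) : (Cmod q < 1)%R ->
  (forall n, qpoch x q n <> 0) ->
  exists m, (0 < m)%R /\ forall n, (m <= Cmod (qpoch x q n))%R.
Proof.
intros hq hx.
assert (hN : exists N, (Cmod (x * q ^ N) / (1 - Cmod q) <= 1 / 2)%R).
{ assert (h : is_lim_seq (fun n => Cmod x / (1 - Cmod q) * Cmod q ^ n)%R 0).
  { replace (Finite 0) with (Rbar_mult (Cmod x / (1 - Cmod q))%R 0)
      by (simpl; f_equal; ring).
    apply is_lim_seq_scal_l, is_lim_seq_geom.
    rewrite Rabs_pos_eq; [lra|apply Cmod_ge_0]. }
  apply is_lim_seq_spec in h.
  destruct (h (mkposreal (1 / 2) ltac:(lra))) as [N hN].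
  exists N. specialize (hN N (le_n N)). simpl in hN.
  rewrite Rminus_0_r in hN. rewrite Cmod_mult, Cmod_pow.
  apply Rle_trans with (2 := Rlt_le _ _ hN).
  eapply Rle_trans; [|apply Rle_abs].
  right; field; lra. }
destruct hN as [N hN].
destruct (qpoch_shift_bounded x q hq) as [M hM].
assert (hP : (0 < Cmod (qpoch x q N))%R) by (apply Cmod_gt_0, hx).
assert (hM1 : (1 <= M)%R).
{ specialize (hM O O). simpl in hM. now rewrite Cmod_1 in hM. }
(* For [n >= N] the tail from [N] to [n] is at least 1/2; for [n <= N] the tail from [n] to [N] is
   at most [M]. As [1 <= M], dividing by [2 * M] covers both cases. *)
exists (Cmod (qpoch x q N) / (2 * M))%R.
split; [apply Rdiv_lt_0_compat; lra|].
intro n.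
apply Rle_div_l; [lra|].
assert (hn := Cmod_ge_0 (qpoch x q n)).
destruct (Nat.le_ge_cases n N) as [h|h].
- replace N with (n + (N - n))%nat by lia.
  rewrite qpoch_add, Cmod_mult.
  apply Rmult_le_compat_l; [exact hn|].
  specialize (hM n (N - n)%nat). lra.
- assert (hl := qpoch_lower_bound (x * q ^ N) q (n - N) hq hN).
  assert (hs : (Cmod (x * q ^ N) * ((1 - Cmod q ^ (n - N)) / (1 - Cmod q))
                <= 1 / 2)%R).
  { apply Rle_trans with (2 := hN).
    apply Rmult_le_compat_l; [apply Cmod_ge_0|].
    rewrite <- (Rmult_1_l (/ (1 - Cmod q))).
    apply Rmult_le_compat_r.
    - left; apply Rinv_0_lt_compat; lra.
    - generalize (pow_le (Cmod q) (n - N) (Cmod_ge_0 q)). lra. }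
  assert (e : Cmod (qpoch x q n)
    = (Cmod (qpoch x q N) * Cmod (qpoch (x * q ^ N) q (n - N)))%R).
  { rewrite <- Cmod_mult, <- qpoch_add. do 2 f_equal. lia. }
  rewrite e. nra.
Qed.

Lemma qpoch_inf_neq_0 (x q : C) : (Cmod q < 1)%R ->
  (forall n, qpoch x q n <> 0) -> qpoch_inf x q <> 0.
Proof.
intros hq hx h0.
destruct (qpoch_away_from_0 x q hq hx) as [m [hm hb]].
assert (h := qpoch_inf_correct x q hq). rewrite h0 in h.
destruct (proj1 (@filterlim_locally_ball_norm C_AbsRing nat C_NormedModule
  eventually _ (qpoch x q) (RtoC 0)) h (mkposreal m hm)) as [N hN].
specialize (hN N (le_n N)). change (Cmod (qpoch x q N - 0) < m)%R in hN.
specialize (hb N). replace (qpoch x q N - 0) with (qpoch x q N) in hN by ring.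
lra.
Qed.

Lemma qpoch_neq_0_shift (x q : C) (k n : nat) :
  (forall n, qpoch x q n <> 0) -> qpoch (x * q ^ k) q n <> 0.
Proof.
intros hx h. apply (hx (k + n)%nat). rewrite qpoch_add, h. ring.
Qed.

(** (x q^k;q)_n is the quotient of (x;q)_(k+n), bounded below, by (x;q)_k, bounded above, and
    neither bound depends on [k] or [n]. *)
Lemma qpoch_shift_inv_bounded (x q : C) : (Cmod q < 1)%R ->
  (forall n, qpoch x q n <> 0) ->
  exists M, forall k n, (Cmod (/ qpoch (x * q ^ k) q n) <= M)%R.
Proof.
intros hq hx.
destruct (qpoch_away_from_0 x q hq hx) as [m [hm hb]].
destruct (qpoch_shift_bounded x q hq) as [M hM].
exists (M / m)%R. intros k n.
rewrite Cmod_inv by now apply qpoch_neq_0_shift.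
assert (h := hb (k + n)%nat). rewrite qpoch_add, Cmod_mult in h.
assert (hk : (Cmod (qpoch x q k) <= M)%R).
{ specialize (hM O k). simpl in hM. now rewrite Cmult_1_r in hM. }
assert (hp : (0 < Cmod (qpoch (x * q ^ k) q n))%R)
  by now apply Cmod_gt_0, qpoch_neq_0_shift.
apply Rle_div_r; [exact hm|]. rewrite Rmult_comm.
apply Rle_div_l; [exact hp|].
eapply Rle_trans; [exact h|]. nra.
Qed.

(** * Splitting off the first factor; limits of products *)

Lemma qpoch_succ_l (x q : C) (n : nat) :
  qpoch x q (S n) = (1 - x) * qpoch (x * q) q n.
Proof.
replace (S n) with (1 + n)%nat by lia. rewrite qpoch_add. simpl.
rewrite !Cmult_1_r. ring.
Qed.

Lemma qpoch_inf_succ (x q : C) : (Cmod q < 1)%R ->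
  qpoch_inf x q = (1 - x) * qpoch_inf (x * q) q.
Proof.
intro hq.
apply (Cfilterlim_unique (fun n => qpoch x q (S n))).
- intros P hP. destruct (qpoch_inf_correct x q hq P hP) as [N hN].
  exists N. intros n hn. apply hN. lia.
- eapply filterlim_ext; [intro n; symmetry; apply qpoch_succ_l|].
  apply (Cfilterlim_mult (fun _ => 1 - x)); [apply filterlim_const|].
  now apply qpoch_inf_correct.
Qed.

Lemma filterlim_qpochs (xs : list C) (q : C) : (Cmod q < 1)%R ->
  filterlim (qpochs xs q) eventually (locally (qpochs_inf xs q)).
Proof.
intro hq. induction xs as [|x xs IH].
- apply (filterlim_const (F := eventually) (U := C_UniformSpace) (RtoC 1)).
- apply (Cfilterlim_mult (qpoch x q) (qpochs xs q)); [|exact IH].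
  now apply qpoch_inf_correct.
Qed.

(** * Well-poised terms and their shift-uniform bounds *)

(* The well-poised factor of the summand of
   [6phi5(a, q a^(1/2), -q a^(1/2), b, c, d; q, aq/(bcd))], parametrized by
   [B = aq/b] instead of [b] so that [a = b = 0] is not excluded. *)
Definition wp_term (q a B c d : C) (n : nat) : C :=
  qpochs [a; a * q / B; c; d] q n / qpochs [q; B; a * q / c; a * q / d] q n
  * (B / (c * d)) ^ n.

(** The factors in q a^(1/2) and -q a^(1/2) of the 6phi5 collapse to (1 - a q^(2n))/(1 - a). The
    constant denominator is dropped, so no square root occurs, [a = 1] is allowed, and the constant
    term is 1 - a. *)
Definition vwp_term (q a B c d : C) (n : nat) : C :=
  (1 - a * (q ^ n * q ^ n)) * wp_term q a B c d n.

Lemma qpochs_neq_0 (x : C) (xs : list C) (q : C) :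
  (forall n, qpochs xs q n <> 0) -> In x xs -> forall n, qpoch x q n <> 0.
Proof.
induction xs as [|y xs IH]; [contradiction|].
intros h hx n.
destruct hx as [->|hx].
- intro h0. apply (h n). simpl. rewrite h0. ring.
- apply IH; [|exact hx]. intros k h0. apply (h k). simpl. rewrite h0. ring.
Qed.

(** Shifting [a] and [B] together fixes a q / B, c and d, and multiplies the other parameters except
    the denominator parameter [q] by q^k, where the shift-uniform bounds apply. The argument also
    gains q^k; this makes all terms with [n > 0] disappear as [k] grows. *)
Lemma wp_term_bound (q a B c d : C) : (0 < Cmod q < 1)%R ->
  B <> 0 -> c <> 0 -> d <> 0 ->
  (forall n, qpochs [q; B; a * q / c; a * q / d] q n <> 0) ->
  exists K, forall k n, (Cmod (wp_term q (a * q ^ k) (B * q ^ k) c d n)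
    <= K * (Cmod (B / (c * d)) * Cmod q ^ k) ^ n)%R.
Proof.
intros [hq0 hq] hB hc hd hden.
assert (hqn : q <> 0) by now apply Cmod_gt_0.
destruct (qpoch_shift_bounded a q hq) as [M1 h1].
destruct (qpoch_shift_bounded (a * q / B) q hq) as [M2 h2].
destruct (qpoch_shift_bounded c q hq) as [M3 h3].
destruct (qpoch_shift_bounded d q hq) as [M4 h4].
assert (n5 : forall n, qpoch q q n <> 0)
  by (apply (qpochs_neq_0 _ _ _ hden); simpl; auto).
assert (n6 : forall n, qpoch B q n <> 0)
  by (apply (qpochs_neq_0 _ _ _ hden); simpl; auto).
assert (n7 : forall n, qpoch (a * q / c) q n <> 0)
  by (apply (qpochs_neq_0 _ _ _ hden); simpl; auto).
assert (n8 : forall n, qpoch (a * q / d) q n <> 0)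
  by (apply (qpochs_neq_0 _ _ _ hden); simpl; auto).
destruct (qpoch_shift_inv_bounded _ q hq n5) as [M5 h5].
destruct (qpoch_shift_inv_bounded _ q hq n6) as [M6 h6].
destruct (qpoch_shift_inv_bounded _ q hq n7) as [M7 h7].
destruct (qpoch_shift_inv_bounded _ q hq n8) as [M8 h8].
exists (M1 * (M2 * (M3 * (M4 * (M5 * (M6 * (M7 * M8)))))))%R.
intros k n.
assert (hk : q ^ k <> 0) by now apply Cpow_nz.
specialize (h1 k n). specialize (h6 k n). specialize (h7 k n).
specialize (h8 k n). specialize (h2 O n). specialize (h3 O n).
specialize (h4 O n). specialize (h5 O n).
simpl in h2, h3, h4, h5. rewrite Cmult_1_r in h2, h3, h4, h5.
assert (e : wp_term q (a * q ^ k) (B * q ^ k) c d n =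
  qpoch (a * q ^ k) q n * (qpoch (a * q / B) q n * (qpoch c q n * (qpoch d q n
  * (/ qpoch q q n * (/ qpoch (B * q ^ k) q n * (/ qpoch (a * q / c * q ^ k) q n
  * / qpoch (a * q / d * q ^ k) q n)))))) * (B / (c * d) * q ^ k) ^ n).
{ unfold wp_term, qpochs, fold_right.
  replace (a * q ^ k * q / (B * q ^ k)) with (a * q / B) by (field; auto).
  replace (a * q ^ k * q / c) with (a * q / c * q ^ k) by (field; auto).
  replace (a * q ^ k * q / d) with (a * q / d * q ^ k) by (field; auto).
  replace (B * q ^ k / (c * d)) with (B / (c * d) * q ^ k) by (field; auto).
  field. repeat split; auto using qpoch_neq_0_shift. }
rewrite e, !Cmod_mult, Cmod_pow, Cmod_mult, Cmod_pow.
apply Rmult_le_compat_r.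
- apply pow_le, Rmult_le_pos; [|apply pow_le]; apply Cmod_ge_0.
- repeat (apply Rmult_le_compat;
    [apply Cmod_ge_0|repeat apply Rmult_le_pos; apply Cmod_ge_0|assumption|]);
  assumption.
Qed.

Lemma Cmod_one_minus_le (x : C) : (Cmod (1 - x) <= 1 + Cmod x)%R.
Proof.
eapply Rle_trans; [apply Cmod_triangle|]. rewrite Cmod_1, Cmod_opp. lra.
Qed.

Lemma vwp_term_bound (q a B c d : C) : (0 < Cmod q < 1)%R ->
  B <> 0 -> c <> 0 -> d <> 0 ->
  (forall n, qpochs [q; B; a * q / c; a * q / d] q n <> 0) ->
  exists K, forall k n, (Cmod (vwp_term q (a * q ^ k) (B * q ^ k) c d n)
    <= K * (Cmod (B / (c * d)) * Cmod q ^ k) ^ n)%R.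
Proof.
intros hq hB hc hd hden.
destruct (wp_term_bound q a B c d hq hB hc hd hden) as [K hK].
exists ((1 + Cmod a) * K)%R. intros k n.
unfold vwp_term. rewrite Cmod_mult, Rmult_assoc.
apply Rmult_le_compat; try apply Cmod_ge_0; [|apply hK].
eapply Rle_trans; [apply Cmod_one_minus_le|]. apply Rplus_le_compat_l.
replace (a * q ^ k * (q ^ n * q ^ n)) with (a * q ^ k * q ^ n * q ^ n) by ring.
destruct hq as [_ hq].
do 2 (eapply Rle_trans; [apply Cmod_mul_pow_le; exact hq|]).
apply Cmod_mul_pow_le; exact hq.
Qed.

(** * The first-order recurrence in the shift *)

(* The WZ certificate of the shift [(a, B) -> (aq, Bq)]. *)
Lemma vwp_term_telescope (q a B c d : C) (n : nat) : (0 < Cmod q < 1)%R ->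
  B <> 0 -> c <> 0 -> d <> 0 ->
  (forall n, qpochs [q; B; a * q / c; a * q / d] q n <> 0) ->
  let z := B / (c * d) in
  let G := fun n => (1 - B) * (1 - a * q / c) * (1 - a * q / d)
                    * (1 - q ^ n) * (a * z * q ^ n - 1) * wp_term q a B c d n in
  (1 - B) * (1 - a * q / c) * (1 - a * q / d) * (1 - z) * vwp_term q a B c d n
  - (1 - a) * (1 - B / c) * (1 - B / d) * (1 - a * q / (c * d))
    * vwp_term q (a * q) (B * q) c d n
  = G (S n) - G n.
Proof.
intros hq hB hc hd hden z G.
assert (hqn : q <> 0) by now apply Cmod_gt_0.
assert (n5 : forall n, qpoch q q n <> 0)
  by (apply (qpochs_neq_0 _ _ _ hden); simpl; auto).
assert (n6 : forall n, qpoch B q n <> 0)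
  by (apply (qpochs_neq_0 _ _ _ hden); simpl; auto).
assert (n7 : forall n, qpoch (a * q / c) q n <> 0)
  by (apply (qpochs_neq_0 _ _ _ hden); simpl; auto).
assert (n8 : forall n, qpoch (a * q / d) q n <> 0)
  by (apply (qpochs_neq_0 _ _ _ hden); simpl; auto).
assert (step : forall y, (forall k, qpoch y q k <> 0) ->
  1 - y <> 0 /\ 1 - y * q ^ n <> 0 /\
  qpoch (y * q) q n = qpoch y q n * (1 - y * q ^ n) / (1 - y)).
{ intros y hy.
  assert (h1 : 1 - y <> 0).
  { intro h. apply (hy 1%nat). simpl. rewrite Cmult_1_r, h. ring. }
  split; [exact h1|split].
  - intro h. apply (hy (S n)). simpl. rewrite h. ring.
  - change (qpoch y q n * (1 - y * q ^ n)) with (qpoch y q (S n)).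
    rewrite qpoch_succ_l. field. exact h1. }
destruct (step _ n5) as [_ [s5 _]].
destruct (step _ n6) as [s6 [s6' e6]].
destruct (step _ n7) as [s7 [s7' e7]].
destruct (step _ n8) as [s8 [s8' e8]].
(* Unlike the denominator parameters, [a] may equal 1, so this relation is kept free of division. *)
assert (ea : (1 - a) * qpoch (a * q) q n = qpoch a q n * (1 - a * q ^ n))
  by (rewrite <- qpoch_succ_l; reflexivity).
assert (e' : (1 - a) * wp_term q (a * q) (B * q) c d n =
  (1 - B) * (1 - a * q / c) * (1 - a * q / d) * (1 - a * q ^ n)
  / ((1 - B * q ^ n) * (1 - a * q / c * q ^ n) * (1 - a * q / d * q ^ n))
  * q ^ n * wp_term q a B c d n).
{ unfold wp_term, qpochs, fold_right.
  replace (a * q * q / (B * q)) with (a * q / B) by (field; auto).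
  replace (a * q * q / c) with (a * q / c * q) by (field; auto).
  replace (a * q * q / d) with (a * q / d * q) by (field; auto).
  replace (B * q / (c * d)) with (B / (c * d) * q) by (field; auto).
  rewrite e6, e7, e8, Cpow_mult_l. clear step e6 e7 e8.
  generalize dependent (qpoch (a * q) q n). intros pa ea.
  unfold Cdiv at 1. rewrite !Cmult_assoc, ea.
  specialize (n5 n). specialize (n6 n). specialize (n7 n). specialize (n8 n).
  generalize dependent (qpoch (a * q / c) q n). intros p7 **.
  generalize dependent (qpoch (a * q / d) q n). intros p8 **.
  generalize dependent (a * q / c). intros y7 **.
  generalize dependent (a * q / d). intros y8 **.
  field. repeat split; auto. }
(* The factor 1 - q^(n+1) of the certificate cancels the new factor of (q;q)_(n+1). *)
assert (eS : (1 - q ^ S n) * wp_term q a B c d (S n) =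
  (1 - a * q ^ n) * (1 - a * q / B * q ^ n) * (1 - c * q ^ n) * (1 - d * q ^ n)
  / ((1 - B * q ^ n) * (1 - a * q / c * q ^ n) * (1 - a * q / d * q ^ n))
  * z * wp_term q a B c d n).
{ unfold wp_term, qpochs, fold_right, z. simpl qpoch. rewrite !Cpow_S.
  specialize (n5 n). specialize (n6 n). specialize (n7 n). specialize (n8 n).
  generalize dependent (qpoch (a * q / c) q n). intros p7 **.
  generalize dependent (qpoch (a * q / d) q n). intros p8 **.
  generalize dependent (a * q / c). intros y7 **.
  generalize dependent (a * q / d). intros y8 **.
  generalize (a * q / B) (qpoch (a * q / B) q n) (B / (c * d)).
  intros yb pb w.
  field. repeat split; auto. }
unfold G.
transitivity ((1 - B) * (1 - a * q / c) * (1 - a * q / d)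
  * ((1 - z) * (1 - a * (q ^ n * q ^ n)) * wp_term q a B c d n)
  - (1 - B / c) * (1 - B / d) * (1 - a * q / (c * d))
    * (1 - a * q * (q ^ n * q ^ n))
    * ((1 - a) * wp_term q (a * q) (B * q) c d n)).
{ unfold vwp_term. ring. }
transitivity ((1 - B) * (1 - a * q / c) * (1 - a * q / d)
  * ((a * z * q ^ S n - 1) * ((1 - q ^ S n) * wp_term q a B c d (S n))
     - (1 - q ^ n) * (a * z * q ^ n - 1) * wp_term q a B c d n)); [|ring].
(* Everything is now a rational multiple of [wp_term q a B c d n]; what remains is a rational
   identity with q^n as a free variable. *)
rewrite e', eS, Cpow_S. unfold z. clear - hB hc hd s6' s7' s8'.
generalize dependent (q ^ n). intros x s6' s7' s8'.
generalize (wp_term q a B c d n). intro w.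
assert (hc' : c - a * q * x <> 0).
{ intro h. apply s7'. replace (1 - a * q / c * x) with ((c - a * q * x) / c)
    by (field; auto). rewrite h. field; auto. }
assert (hd' : d - a * q * x <> 0).
{ intro h. apply s8'. replace (1 - a * q / d * x) with ((d - a * q * x) / d)
    by (field; auto). rewrite h. field; auto. }
field. repeat split; auto.
Qed.

(** Summing the telescoping relation leaves only the boundary terms of [G]: the one at 0 vanishes
    through 1 - q^0, the one at infinity because [wp_term] decays like the n-th power of B/(cd). *)
Lemma vwp_series_shift (q a B c d S S' : C) : (0 < Cmod q < 1)%R ->
  B <> 0 -> c <> 0 -> d <> 0 -> (Cmod (B / (c * d)) < 1)%R ->
  (forall n, qpochs [q; B; a * q / c; a * q / d] q n <> 0) ->
  @is_series C_AbsRing C_NormedModule (vwp_term q a B c d) S ->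
  @is_series C_AbsRing C_NormedModule (vwp_term q (a * q) (B * q) c d) S' ->
  (1 - B) * (1 - a * q / c) * (1 - a * q / d) * (1 - B / (c * d)) * S
  = (1 - a) * (1 - B / c) * (1 - B / d) * (1 - a * q / (c * d)) * S'.
Proof.
intros hq hB hc hd hz hden hS hS'.
set (lam := (1 - B) * (1 - a * q / c) * (1 - a * q / d) * (1 - B / (c * d))).
set (mu := (1 - a) * (1 - B / c) * (1 - B / d) * (1 - a * q / (c * d))).
assert (tele := fun n => vwp_term_telescope q a B c d n hq hB hc hd hden).
cbv zeta in tele.
set (G := fun n => (1 - B) * (1 - a * q / c) * (1 - a * q / d) * (1 - q ^ n)
  * (a * (B / (c * d)) * q ^ n - 1) * wp_term q a B c d n).
set (D := fun n => lam * vwp_term q a B c d n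
                   + (- mu) * vwp_term q (a * q) (B * q) c d n).
assert (h1 : @is_series C_AbsRing C_NormedModule D (lam * S + (- mu) * S')).
{ apply (@is_series_plus C_AbsRing C_NormedModule);
    now apply (@is_series_scal C_AbsRing C_NormedModule). }
assert (hsum : forall n, @sum_n C_AbelianMonoid D n = G (Datatypes.S n)).
{ assert (hD : forall n, D n = G (Datatypes.S n) - G n).
  { intro n. unfold D, G, lam, mu. rewrite <- (tele n). ring. }
  induction n as [|n IH].
  - rewrite sum_O, hD. unfold G at 2. simpl. ring.
  - rewrite sum_Sn, IH, hD.
    change (G (Datatypes.S n) + (G (Datatypes.S (Datatypes.S n)) - G (Datatypes.S n))
            = G (Datatypes.S (Datatypes.S n))). ring. }
destruct (wp_term_bound q a B c d hq hB hc hd hden) as [K hK].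
assert (h2 : filterlim (@sum_n C_AbelianMonoid D) eventually (locally (RtoC 0))).
{ set (M := Cmod ((1 - B) * (1 - a * q / c) * (1 - a * q / d))).
  set (z := B / (c * d)) in *.
  (* 2 bounds |1 - q^(n+1)| and 1 + |az| bounds |a z q^(n+1) - 1|; the last |z| appears because the
     partial sum up to [n] is [G] at n + 1. *)
  apply (Cfilterlim_bound _ _ (M * 2 * (1 + Cmod (a * z)) * K * Cmod z) (Cmod z)).
  - split; [apply Cmod_ge_0|exact hz].
  - intro n. rewrite hsum.
    replace (G (Datatypes.S n) - 0) with (G (Datatypes.S n)) by ring.
    unfold G. rewrite !(Cmod_mult _ (wp_term _ _ _ _ _ _)),
      (Cmod_mult _ (a * z * _ - 1)), (Cmod_mult _ (1 - _ ^ _)).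
    fold M.
    specialize (hK O (Datatypes.S n)).
    rewrite !Cmult_1_r in hK. change (Cmod q ^ 0)%R with 1%R in hK.
    rewrite Rmult_1_r in hK. fold z in hK.
    replace (M * 2 * (1 + Cmod (a * z)) * K * Cmod z * Cmod z ^ n)%R
      with (M * 2 * (1 + Cmod (a * z)) * (K * Cmod z ^ Datatypes.S n))%R
      by (simpl; ring).
    destruct hq as [_ hq].
    assert (hM : (0 <= M)%R) by apply Cmod_ge_0.
    assert (b1 : (Cmod (1 - q ^ Datatypes.S n) <= 2)%R).
    { eapply Rle_trans; [apply Cmod_one_minus_le|].
      generalize (Cmod_mul_pow_le 1 q (Datatypes.S n) hq).
      rewrite Cmult_1_l, Cmod_1. lra. }
    assert (b2 : (Cmod (a * z * q ^ Datatypes.S n - 1) <= 1 + Cmod (a * z))%R).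
    { replace (a * z * q ^ Datatypes.S n - 1)
        with (- (1 - a * z * q ^ Datatypes.S n)) by ring.
      rewrite Cmod_opp.
      eapply Rle_trans; [apply Cmod_one_minus_le|].
      generalize (Cmod_mul_pow_le (a * z) q (Datatypes.S n) hq). lra. }
    apply Rmult_le_compat; [|apply Cmod_ge_0| |exact hK].
    + repeat apply Rmult_le_pos; try apply Cmod_ge_0; exact hM.
    + apply Rmult_le_compat; [|apply Cmod_ge_0| |exact b2].
      * apply Rmult_le_pos; [exact hM|apply Cmod_ge_0].
      * now apply Rmult_le_compat_l. }
assert (e := Cfilterlim_unique _ _ _ h1 h2).
replace (lam * S) with (lam * S + - mu * S' + mu * S') by ring.
rewrite e. ring.
Qed.

(** * The nonterminating 6phi5 sum *)

Lemma qpoch_neq_0_small (x q : C) (n : nat) :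
  (Cmod x < 1)%R -> (Cmod q < 1)%R -> qpoch x q n <> 0.
Proof.
intros hx hq. induction n as [|n IH]; simpl.
- exact C1_nz.
- apply Cmult_neq_0; [exact IH|]. intro h.
  assert (e : x * q ^ n = 1) by (rewrite <- (Cplus_0_l (x * q ^ n)), <- h; ring).
  generalize (Cmod_mul_pow_le x q n hq). rewrite e, Cmod_1. lra.
Qed.

(** One constant [K] dominates all shifted series, so their sums tend to 1, while the factors
    accumulated by the shifts become the infinite products. The numerator has [a] in place of the
    classical [a q] because [vwp_term] carries an extra 1 - a. *)
Theorem vwp_6phi5_sum (q a B c d : C) : (0 < Cmod q < 1)%R ->
  B <> 0 -> c <> 0 -> d <> 0 -> (Cmod (B / (c * d)) < 1)%R ->
  (forall n, qpochs [q; B; a * q / c; a * q / d] q n <> 0) ->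
  @is_series C_AbsRing C_NormedModule (vwp_term q a B c d)
    (qpochs_inf [a; B / c; B / d; a * q / (c * d)] q
     / qpochs_inf [B; a * q / c; a * q / d; B / (c * d)] q).
Proof.
intros hq hB hc hd hz hden.
assert (hqn : q <> 0) by now apply Cmod_gt_0.
destruct (vwp_term_bound q a B c d hq hB hc hd hden) as [K hK].
set (z := B / (c * d)) in *.
assert (hz0 := Cmod_ge_0 z).
assert (hqk : forall k, (0 <= Cmod q ^ k <= 1)%R).
{ intro k. split; [apply pow_le; lra|].
  rewrite <- (pow1 k). apply pow_incr. lra. }
assert (hr : forall k, (0 <= Cmod z * Cmod q ^ k < 1)%R).
{ intro k. specialize (hqk k). split; [apply Rmult_le_pos; lra|nra]. }
set (t := fun k => vwp_term q (a * q ^ k) (B * q ^ k) c d) in *.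
(* The sums are needed as one sequence in [k]; [iota] selects each from its existence. *)
pose (S := (fun k => iota (T := C_CompleteNormedModule)
  (fun l : C => filterlim (@sum_n C_AbelianMonoid (t k)) eventually (locally l)))
  : nat -> C).
assert (hS : forall k, @is_series C_AbsRing C_NormedModule (t k) (S k)).
{ intro k.
  destruct (C_ex_series_geom (t k) K _ (hr k) (hK k)) as [l hl].
  assert (e : S k = l)
    by exact (iota_filterlim_locally (V := C_CompleteNormedModule) _ _ hl).
  now rewrite e. }
set (den := [B; a * q / c; a * q / d; z]).
set (num := [a; B / c; B / d; a * q / (c * d)]).
assert (hnz : forall y k n, In y [q; B; a * q / c; a * q / d] ->
  qpoch (y * q ^ k) q n <> 0).
{ intros y k n hy. apply qpoch_neq_0_shift.
  now apply (qpochs_neq_0 y _ q hden). }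
assert (iter : forall k, qpochs den q k * S 0%nat = qpochs num q k * S k).
{ induction k as [|k IH]; [simpl; ring|].
  assert (hk : q ^ k <> 0) by now apply Cpow_nz.
  assert (hdenk : forall n, qpochs [q; B * q ^ k; a * q ^ k * q / c;
                                    a * q ^ k * q / d] q n <> 0).
  { intro n. simpl.
    replace (a * q ^ k * q / c) with (a * q / c * q ^ k) by (field; auto).
    replace (a * q ^ k * q / d) with (a * q / d * q ^ k) by (field; auto).
    assert (h := hnz q 0%nat n). rewrite Cmult_1_r in h.
    repeat apply Cmult_neq_0; try apply hnz; try apply h; simpl; auto.
    exact C1_nz. }
  assert (hzk : (Cmod (B * q ^ k / (c * d)) < 1)%R).
  { replace (B * q ^ k / (c * d)) with (z * q ^ k) by (unfold z; field; auto).
    rewrite Cmod_mult, Cmod_pow. apply hr. }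
  assert (h1 := hS (Datatypes.S k)). unfold t in h1. rewrite Cpow_S in h1.
  replace (a * (q * q ^ k)) with (a * q ^ k * q) in h1 by ring.
  replace (B * (q * q ^ k)) with (B * q ^ k * q) in h1 by ring.
  assert (hBk : B * q ^ k <> 0) by now apply Cmult_neq_0.
  assert (e := vwp_series_shift q _ _ c d _ _ hq hBk hc hd hzk hdenk (hS k) h1).
  replace (B * q ^ k / (c * d)) with (z * q ^ k) in e by (unfold z; field; auto).
  replace (a * q ^ k * q / c) with (a * q / c * q ^ k) in e by (field; auto).
  replace (a * q ^ k * q / d) with (a * q / d * q ^ k) in e by (field; auto).
  replace (a * q ^ k * q / (c * d)) with (a * q / (c * d) * q ^ k) in e
    by (field; auto).
  replace (B * q ^ k / c) with (B / c * q ^ k) in e by (field; auto).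
  replace (B * q ^ k / d) with (B / d * q ^ k) in e by (field; auto).
  transitivity (qpochs den q k * S 0%nat * ((1 - B * q ^ k)
    * (1 - a * q / c * q ^ k) * (1 - a * q / d * q ^ k) * (1 - z * q ^ k)));
    [simpl; ring|].
  rewrite IH.
  transitivity (qpochs num q k * ((1 - B * q ^ k)
    * (1 - a * q / c * q ^ k) * (1 - a * q / d * q ^ k) * (1 - z * q ^ k)
    * S k)); [ring|].
  rewrite e. simpl. ring. }
assert (hlim : filterlim S eventually (locally (RtoC 1))).
{ apply (Cfilterlim_bound _ _ (K / (1 - Cmod z) + Cmod a) (Cmod q)); [lra|].
  intro k.
  assert (ht0 : t k 0%nat = 1 - a * q ^ k).
  { unfold t, vwp_term, wp_term. simpl. field. }
  assert (hK0 : (0 <= K)%R).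
  { assert (h := hK k 0%nat). rewrite pow_O in h.
    generalize (Cmod_ge_0 (t k 0%nat)). unfold t. lra. }
  assert (htail : (Cmod (S k - t k 0%nat)
                   <= K * Cmod q ^ k / (1 - Cmod z))%R).
  { apply (C_series_geom_bound (fun n => t k (Datatypes.S n))); [lra| |].
    - intro n. eapply Rle_trans; [apply hK|].
      rewrite Rmult_assoc. apply Rmult_le_compat_l; [exact hK0|].
      rewrite <- tech_pow_Rmult, Rpow_mult_distr.
      assert (h1 := pow_le (Cmod z) n hz0).
      assert (h2 : (0 <= (Cmod q ^ k) ^ n <= 1)%R).
      { split; [apply pow_le, hqk|].
        rewrite <- (pow1 n). apply pow_incr, hqk. }
      specialize (hqk k).
      apply Rle_trans with (1 * Cmod q ^ k * (Cmod z ^ n * 1))%R; [|lra].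
      apply Rmult_le_compat; [apply hr|apply Rmult_le_pos; lra| |].
      + apply Rmult_le_compat_r; lra.
      + apply Rmult_le_compat_l; lra.
    - apply (@is_series_incr_1 C_AbsRing C_NormedModule).
      change (plus (S k - t k 0%nat) (t k 0%nat))
        with (S k - t k 0%nat + t k 0%nat).
      replace (S k - t k 0%nat + t k 0%nat) with (S k) by ring. apply hS. }
  rewrite ht0 in htail.
  replace (S k - 1) with (S k - (1 - a * q ^ k) + - (a * q ^ k)) by ring.
  eapply Rle_trans; [apply Cmod_triangle|].
  rewrite Cmod_opp, Cmod_mult, Cmod_pow.
  replace ((K / (1 - Cmod z) + Cmod a) * Cmod q ^ k)%R
    with (K * Cmod q ^ k / (1 - Cmod z) + Cmod a * Cmod q ^ k)%R
    by (field; lra).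
  now apply Rplus_le_compat_r. }
assert (e : qpochs_inf den q * S 0%nat = qpochs_inf num q * 1).
{ apply (Cfilterlim_unique (fun k => qpochs den q k * S 0%nat)).
  - apply (Cfilterlim_mult (qpochs den q) (fun _ => S 0%nat));
      [now apply filterlim_qpochs|apply filterlim_const].
  - eapply filterlim_ext; [intro k; symmetry; apply iter|].
    apply Cfilterlim_mult; [now apply filterlim_qpochs|exact hlim]. }
assert (hdi : qpochs_inf den q <> 0).
{ simpl.
  assert (h : forall y, In y [q; B; a * q / c; a * q / d] ->
    qpoch_inf y q <> 0).
  { intros y hy. apply qpoch_inf_neq_0; [lra|]. intro n.
    generalize (hnz y 0%nat n hy). now rewrite Cmult_1_r. }
  repeat apply Cmult_neq_0; try (apply h; simpl; now auto).
  (* The parameter [z] is not among the denominators of [hden]; |z| < 1 keeps its factors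
     nonzero. *)
  - apply qpoch_inf_neq_0; [lra|]. intro n. apply qpoch_neq_0_small; lra.
  - exact C1_nz. }
assert (h0 := hS 0%nat). unfold t in h0. rewrite !Cmult_1_r in h0.
replace (qpochs_inf num q / qpochs_inf den q) with (S 0%nat); [exact h0|].
rewrite <- (Cmult_1_r (qpochs_inf num q)), <- e. field. exact hdi.
Qed.

(** * From base q^2 to base q, and the final summation *)

Lemma qpoch_sqr (x q : C) (n : nat) :
  qpoch (x ^ 2) (q ^ 2) n = qpoch x q n * qpoch (- x) q n.
Proof.
induction n as [|n IH]; [simpl; ring|].
change (qpoch (x ^ 2) (q ^ 2) n * (1 - x ^ 2 * (q ^ 2) ^ n)
  = qpoch x q n * (1 - x * q ^ n) * (qpoch (- x) q n * (1 - - x * q ^ n))).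
rewrite IH.
replace ((q ^ 2) ^ n) with (q ^ n * q ^ n)
  by (rewrite <- Cpow_mult_l; f_equal; ring).
ring.
Qed.

(** Consecutive factors cancel. With [x = a] this yields the very-well-poised factor, with [x = - a]
    the extra factor 1 + a q^(2n). *)
Lemma qpoch_base_sqr_shift (x q : C) (n : nat) : 1 - x <> 0 ->
  qpoch (x * q ^ 2) (q ^ 2) n
  = qpoch x (q ^ 2) n * (1 - x * (q ^ n * q ^ n)) / (1 - x).
Proof.
intro hx.
replace (q ^ n * q ^ n) with ((q ^ 2) ^ n)
  by (rewrite <- Cpow_mult_l; f_equal; ring).
change (qpoch x (q ^ 2) n * (1 - x * (q ^ 2) ^ n)) with (qpoch x (q ^ 2) (S n)).
rewrite qpoch_succ_l. field. exact hx.
Qed.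

Theorem theorem1p1 (q a s t : C)
  (hq : (0 < Cmod q < 1)%R)
  (hs : s <> 0) (ht : t <> 0)
  (hst : (Cmod (1 / (s * t)) < 1)%R)
  (hden : forall n : nat,
     qpochs [q ^ 2; a; - a] (q ^ 2) n * qpochs [a * q / s; a * q / t] q n <> 0)
  (hden_inf :
     qpochs_inf [- q; a * q / s; a * q / t; - (1 / (s * t))] q <> 0) :
  @is_series C_AbsRing C_NormedModule
    (fun n : nat =>
       (qpochs [a ^ 2; a * q ^ 2; - (a * q ^ 2)] (q ^ 2) n * qpochs [s; t] q n)
       / (qpochs [q ^ 2; a; - a] (q ^ 2) n * qpochs [a * q / s; a * q / t] q n)
       * (- (1 / (s * t))) ^ n)
    ((s + t) / (s * t)
     * (qpochs_inf [a * q; - (q / s); - (q / t); a * q / (s * t)] q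
        / qpochs_inf [- q; a * q / s; a * q / t; - (1 / (s * t))] q)).
Proof.
assert (hqn : q <> 0) by now apply Cmod_gt_0.
assert (hq1 : (Cmod q < 1)%R) by lra.
assert (hdenl : forall y, In y [q ^ 2; a; - a] ->
  forall n, qpoch y (q ^ 2) n <> 0).
{ intros y hy. apply (qpochs_neq_0 y [q ^ 2; a; - a]); [|exact hy].
  intros n h. apply (hden n). rewrite h. ring. }
assert (hdenr : forall y, In y [a * q / s; a * q / t] ->
  forall n, qpoch y q n <> 0).
{ intros y hy. apply (qpochs_neq_0 y [a * q / s; a * q / t]); [|exact hy].
  intros n h. apply (hden n). rewrite h. ring. }
assert (nq : forall n, qpoch q q n <> 0 /\ qpoch (- q) q n <> 0).
{ intro n. assert (h := hdenl (q ^ 2) ltac:(simpl; auto) n).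
  rewrite qpoch_sqr in h. split; intro h0; apply h; rewrite h0; ring. }
assert (ns := hdenr (a * q / s) ltac:(simpl; auto)).
assert (nt := hdenr (a * q / t) ltac:(simpl; auto)).
assert (na := hdenl a ltac:(simpl; auto)).
assert (nma := hdenl (- a) ltac:(simpl; auto)).
assert (first : forall y r, qpoch y r 1 <> 0 -> 1 - y <> 0).
{ intros y r h h0. apply h. simpl. rewrite Cmult_1_r, h0. ring. }
assert (ha := first _ _ (na 1%nat)).
assert (hma := first _ _ (nma 1%nat)).
assert (hs1 := first _ _ (ns 1%nat)).
assert (ht1 := first _ _ (nt 1%nat)).
assert (hmq := first _ _ (proj2 (nq 1%nat))).
set (w := - (1 / (s * t))) in *.
assert (hw : (Cmod w < 1)%R) by (unfold w; now rewrite Cmod_opp).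
assert (hw1 := first w q (qpoch_neq_0_small w q 1 hw hq1)).
assert (hden1 : forall n, qpochs [q; - q; a * q / s; a * q / t] q n <> 0).
{ intro n. simpl. destruct (nq n).
  repeat apply Cmult_neq_0; auto. exact C1_nz. }
assert (hmqn : - q <> 0) by (intro h; apply hqn; replace q with (- - q) by ring;
  rewrite h; ring).
assert (hz1 : - q / (s * t) = w * q) by (unfold w; field; auto).
(* [B = - q] encodes b = -a; the argument becomes [w * q]. *)
assert (h1 := vwp_6phi5_sum q a (- q) s t hq hmqn hs ht).
rewrite hz1 in h1.
specialize (h1 ltac:(generalize (Cmod_mul_pow_le w q 1 hq1); simpl;
  rewrite Cmult_1_r; lra) hden1).
assert (hz2 : - q * q / (s * q * (t * q)) = w) by (unfold w; field; auto).
assert (es : a * q * q * q / (s * q) = a * q / s * q) by (field; auto).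
assert (et : a * q * q * q / (t * q) = a * q / t * q) by (field; auto).
(* [B = - q * q] encodes b = -aq relative to a q^2; here the argument is exactly [w]. *)
assert (h2 := vwp_6phi5_sum q (a * q * q) (- q * q) (s * q) (t * q) hq
  ltac:(now apply Cmult_neq_0) ltac:(now apply Cmult_neq_0)
  ltac:(now apply Cmult_neq_0)).
rewrite hz2, es, et in h2.
assert (sh : forall y n, (forall n, qpoch y q n <> 0) -> qpoch (y * q) q n <> 0).
{ intros y n h. generalize (qpoch_neq_0_shift y q 1 n h). simpl.
  now rewrite Cmult_1_r. }
specialize (h2 hw).
assert (hden2 : forall n,
  qpochs [q; - q * q; a * q / s * q; a * q / t * q] q n <> 0).
{ intro n. simpl. destruct (nq n).
  repeat apply Cmult_neq_0; auto; [|exact C1_nz]. apply sh. intro; apply nq. }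
specialize (h2 hden2).
(* Normalized by the first nonzero position: [E 1] is [kappa] times 1 - a q^2, the constant term of
   the shifted series. *)
set (kappa := w * (1 - a * q) * (1 - s) * (1 - t)
  / ((1 - - q) * (1 - a * q / s) * (1 - a * q / t))).
(* The part of the summand left after subtracting the first 6phi5 series. *)
set (E := fun n => (1 - a * (q ^ n * q ^ n)) * (1 - q ^ n) * (1 - a * q ^ n)
  / ((1 - a) * (1 - - a))
  * (qpochs [a; - a; s; t] q n / qpochs [q; - q; a * q / s; a * q / t] q n)
  * w ^ n).
assert (hE : forall n,
  E (S n) = kappa * vwp_term q (a * q * q) (- q * q) (s * q) (t * q) n).
{ intro n. unfold E, kappa, vwp_term, wp_term.
  rewrite hz2, es, et.
  replace (a * q * q * q / (- q * q)) with (- a * q) by (field; auto).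
  assert (eq1 : qpoch q q (S n) = qpoch q q n * (1 - q ^ S n))
    by (simpl; ring).
  (* The factor 1 - a q^(n+1) extends (a;q)_(n+1) by one place, so [a] moves by q^2 while -a, s and
     t move by q. *)
  assert (ea1 : qpoch a q (S n) * (1 - a * q ^ S n)
    = (1 - a) * (1 - a * q) * qpoch (a * q * q) q n).
  { transitivity (qpoch a q (S (S n))); [reflexivity|].
    rewrite !qpoch_succ_l. ring. }
  assert (hqS : 1 - q ^ S n <> 0).
  { intro h. apply (proj1 (nq (S n))). rewrite eq1, h. ring. }
  assert (nq' := proj1 (nq n)).
  assert (nmq := sh (- q) n (fun k => proj2 (nq k))).
  assert (ns' := sh _ n ns). assert (nt' := sh _ n nt).
  unfold qpochs, fold_right.
  rewrite eq1, (qpoch_succ_l (- a)), (qpoch_succ_l s), (qpoch_succ_l t),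
    (qpoch_succ_l (- q)), (qpoch_succ_l (a * q / s)), (qpoch_succ_l (a * q / t)).
  clear - ea1 ha hma hs1 ht1 hmq hqS nq' nmq ns' nt'.
  generalize dependent (qpoch (a * q / s * q) q n). intros p1 ?.
  generalize dependent (qpoch (a * q / t * q) q n). intros p2 ?.
  generalize dependent (a * q / s). intros y1 ?.
  generalize dependent (a * q / t). intros y2 ?.
  generalize dependent (qpoch (- q * q) q n). intros p3 ?.
  generalize dependent (qpoch q q n). intros p4 ?.
  generalize (qpoch (- a * q) q n) (qpoch (s * q) q n) (qpoch (t * q) q n).
  intros p5 p6 p7.
  replace (1 - a * (q ^ S n * q ^ S n))
    with (1 - a * q * q * (q ^ n * q ^ n)) by (rewrite Cpow_S; ring).
  rewrite (Cpow_S w).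
  generalize dependent (qpoch a q (S n)). intros pa ea1.
  generalize dependent (q ^ S n). intros x hx ea1.
  generalize dependent (qpoch (a * q * q) q n). intros pa' ea1.
  assert (epa : (1 - a * x) * pa = (1 - a) * (1 - a * q) * pa')
    by (rewrite <- ea1; ring).
  transitivity ((1 - a * q * q * (q ^ n * q ^ n)) * ((1 - a * x) * pa)
    / (1 - a) * p5 * (1 - s) * p6 * (1 - t) * p7
    / (p4 * (1 - - q) * p3 * (1 - y1) * p1 * (1 - y2) * p2) * w * w ^ n).
  - field. repeat split; auto.
  - rewrite epa. field. repeat split; auto. }
assert (h3 := is_series_scal (K := C_AbsRing) (V := C_NormedModule)
  kappa _ _ h2).
match type of h3 with is_series _ ?l => set (L2 := l) in h3 end.
assert (h4 : @is_series C_AbsRing C_NormedModule E L2).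
{ apply (@is_series_decr_1 C_AbsRing C_NormedModule).
  (* [E 0] vanishes through 1 - q^0, so the index shift leaves the sum unchanged. *)
  assert (e0 : forall l : C, l - E 0%nat = l).
  { intro l. unfold E. simpl. field. repeat split; auto. }
  change (@is_series C_AbsRing C_NormedModule (fun k => E (S k)) (L2 - E 0%nat)).
  rewrite e0.
  eapply (@is_series_ext C_AbsRing C_NormedModule); [|exact h3].
  intro n. symmetry. apply hE. }
(* The constant 1 + a of the splitting cancels the denominator 1 + a of the summand; only 1/(1 - a)
   remains. *)
assert (h5 := is_series_scal (K := C_AbsRing) (V := C_NormedModule)
  (/ (1 - a)) _ _ h1).
assert (h6 := @is_series_plus C_AbsRing C_NormedModule _ _ _ _ h5 h4).
match type of h6 with is_series _ ?l => set (L := l) in h6 end.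
match goal with |- is_series _ ?l => replace l with L end.
- eapply (@is_series_ext C_AbsRing C_NormedModule); [|exact h6].
  intro n.
  change (/ (1 - a) * vwp_term q a (- q) s t n + E n =
    (qpochs [a ^ 2; a * q ^ 2; - (a * q ^ 2)] (q ^ 2) n * qpochs [s; t] q n)
    / (qpochs [q ^ 2; a; - a] (q ^ 2) n * qpochs [a * q / s; a * q / t] q n)
    * w ^ n).
  unfold E, vwp_term, wp_term. rewrite hz1, Cpow_mult_l.
  replace (a * q / - q) with (- a) by (field; auto).
  unfold qpochs, fold_right.
  replace (- (a * q ^ 2)) with (- a * q ^ 2) by ring.
  rewrite !qpoch_sqr, !qpoch_base_sqr_shift by assumption.
  specialize (ns n). specialize (nt n). specialize (na n). specialize (nma n).
  destruct (nq n) as [nq1 nq2].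
  clear - ns nt na nma nq1 nq2 ha hma.
  generalize dependent (qpoch (a * q / s) q n). intros p1 ?.
  generalize dependent (qpoch (a * q / t) q n). intros p2 ?.
  generalize dependent (qpoch a (q ^ 2) n). intros p3 ?.
  generalize dependent (qpoch (- a) (q ^ 2) n). intros p4 ?.
  generalize (w ^ n) (q ^ n). intros W x.
  field. repeat split; auto.
- subst L L2.
  change (/ (1 - a) * (qpochs_inf [a; - q / s; - q / t; a * q / (s * t)] q
      / qpochs_inf [- q; a * q / s; a * q / t; w * q] q)
    + kappa * (qpochs_inf [a * q * q; - q * q / (s * q); - q * q / (t * q);
        a * q * q * q / (s * q * (t * q))] q
      / qpochs_inf [- q * q; a * q / s * q; a * q / t * q; w] q)
    = (s + t) / (s * t) * (qpochs_inf [a * q; - (q / s); - (q / t);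
        a * q / (s * t)] q
      / qpochs_inf [- q; a * q / s; a * q / t; w] q)).
  replace (- q * q / (s * q)) with (- (q / s)) by (field; auto).
  replace (- q * q / (t * q)) with (- (q / t)) by (field; auto).
  replace (- q / s) with (- (q / s)) by (field; auto).
  replace (- q / t) with (- (q / t)) by (field; auto).
  replace (a * q * q * q / (s * q * (t * q))) with (a * q / (s * t))
    by (field; auto).
  unfold qpochs_inf, fold_right in *. unfold kappa.
  rewrite (qpoch_inf_succ a), (qpoch_inf_succ (a * q)), (qpoch_inf_succ (- q)),
    (qpoch_inf_succ (a * q / s)), (qpoch_inf_succ (a * q / t)),
    (qpoch_inf_succ w) by assumption.
  assert (i1 : forall y, (forall n, qpoch y q n <> 0) -> qpoch_inf (y * q) q <> 0).
  { intros y h. apply qpoch_inf_neq_0; auto. }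
  assert (i2 := i1 (- q) (fun n => proj2 (nq n))).
  assert (i3 := i1 _ ns). assert (i4 := i1 _ nt).
  assert (i5 := i1 w (fun n => qpoch_neq_0_small w q n hw hq1)).
  assert (ew : s * t * w = - (1)) by (unfold w; field; auto).
  assert (est : (s + t) / (s * t) = - w * (s + t)) by (unfold w; field; auto).
  rewrite est.
  clear - i2 i3 i4 i5 ew ha hs1 ht1 hmq hw1.
  generalize dependent (qpoch_inf (a * q / s * q) q). intros p1 ?.
  generalize dependent (qpoch_inf (a * q / t * q) q). intros p2 ?.
  generalize dependent (a * q / s). intros y1 ?.
  generalize dependent (a * q / t). intros y2 ?.
  generalize dependent (qpoch_inf (- q * q) q). intros p3 ?.
  generalize dependent (qpoch_inf (w * q) q). intros p4 ?.
  generalize (qpoch_inf (a * q * q) q) (qpoch_inf (- (q / s)) q)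
    (qpoch_inf (- (q / t)) q) (qpoch_inf (a * q / (s * t)) q).
  intros p5 p6 p7 p8.
  (* Over the common denominator the two values contribute 1 - w and w(1 - s)(1 - t), whose sum is
     the last bracket; [s * t * w = - (1)] reduces it to -w(s + t). *)
  transitivity ((1 - a * q) * p5 * p6 * p7 * p8
    / ((1 - - q) * p3 * (1 - y1) * p1 * (1 - y2) * p2 * (1 - w) * p4)
    * ((1 + s * t * w) - w * (s + t))).
  + field. repeat split; auto.
  + rewrite ew. field. repeat split; auto.
Qed.
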